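(* Let $k$ be an algebraically closed field of characteristic zero and let $G$ be a finite group. If $G$ has no multiplicities, then $A^2(k[G])$ and $\mathrm{H}^2_\ell(G)$ are abelian groups.
   Context: $G$ has no multiplicities if for all irreducible representations $V_\rho,V_\sigma$ of $G$ over $k$, the tensor product $V_\rho\otimes V_\sigma$ is a multiplicity-free direct sum of irreducible representations, i.e. every irreducible representation occurs in it with multiplicity $0$ or $1$. $k[G]$ is the group algebra with coproduct $\Delta(g)=g\otimes g$ for $g\in G$. $A^2(k[G])$ is the group of invertible elements $F\in k[G]\otimes k[G]$ with $\Delta(a)F=F\Delta(a)$ for all $a\in k[G]$ (i.e. invertible and fixed by diagonal conjugation by $G$). The invariant twists are the $F\in A^2(k[G])$ with $(F\otimes 1)(\Delta\otimes\mathrm{id})(F)=(1\otimes F)(\mathrm{id}\otimes\Delta)(F)$; they form a subgroup $Z^2$. For $a$ in the group $A^1$ of invertible central elements of $k[G]$ put $\delta^1(a)=(a\otimes a)\Delta(a^{-1})$; $\delta^1$ is a homomorphism onto a central subgroup of $Z^2$, and $\mathrm{H}^2_\ell(G)=Z^2/\delta^1(A^1)$. *)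

(* Defs.v *)
From HB Require Import structures.
From mathcomp Require Import all_boot all_order all_algebra all_fingroup.
From mathcomp Require Import all_solvable all_field all_character.
From mathcomp Require Import boolp.

Set Implicit Arguments.
Unset Strict Implicit.
Unset Printing Implicit Defensive.

Import GRing.Theory.
Local Open Scope ring_scope.
Local Open Scope quotient_scope.

(* The group algebra k[G]; its product is convolution, not the pointwise      *)
(* product of {ffun gT -> k}. It is a finite-dimensional algebra, so that     *)
(* falgebra.v provides GRing.unit (two-sided invertibility) and _^-1.         *)
Definition galg (k : fieldType) (gT : finGroupType) : Type := {ffun gT -> k^o}.

HB.instance Definition _ (k : fieldType) (gT : finGroupType) :=
  Vector.copy (galg k gT) {ffun gT -> k^o}.

Section GroupAlgebra.
Variables (k : fieldType) (gT : finGroupType).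
Implicit Types (a b c : galg k gT) (x y z : gT).

Definition gmul a b : galg k gT :=
  [ffun x => \sum_y (a y : k) * (b (y^-1 * x)%g : k)].
Definition gbase x : galg k gT := [ffun y => (x == y)%:R].

Lemma galgP a b : (forall x, a x = b x) -> a = b.
Proof. by move=> ab; apply/ffunP. Qed.

Lemma galg_sumE (I : Type) (r : seq I) (P : pred I) (F : I -> galg k gT) x :
  (\sum_(i <- r | P i) F i) x = \sum_(i <- r | P i) F i x.
Proof.
by elim/big_rec2: _ => [|i y1 y2 _ <-]; [apply: ffunE | apply: ffunE].
Qed.

Lemma galgD a b x : (a + b) x = a x + b x. Proof. exact: ffunE. Qed.
Lemma galgZ (r : k) a x : (r *: a) x = r * (a x : k). Proof. exact: ffunE. Qed.

Lemma gmulE a b x : gmul a b x = \sum_y (a y : k) * (b (y^-1 * x)%g : k).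
Proof. exact: ffunE. Qed.

Lemma gbaseE x y : gbase x y = (x == y)%:R :> k. Proof. exact: ffunE. Qed.

Lemma gmulA : associative gmul.
Proof.
move=> a b c; apply: galgP => z; rewrite !gmulE.
under [RHS]eq_bigr => y _ do rewrite gmulE mulr_suml.
rewrite exchange_big /=; apply: eq_bigr => x _.
rewrite gmulE mulr_sumr (reindex_inj (mulgI x^-1%g)) /=.
by apply: eq_bigr => y _; rewrite mulrA invMg invgK -!mulgA mulKVg.
Qed.

Lemma gmul1l : left_id (gbase 1%g) gmul.
Proof.
move=> a; apply: galgP => x; rewrite gmulE (bigD1 1%g) //= big1 ?addr0.
  by rewrite gbaseE eqxx mul1r invg1 mul1g.
by move=> y ny; rewrite gbaseE eq_sym (negPf ny) mul0r.
Qed.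

Lemma gmul1r : right_id (gbase 1%g) gmul.
Proof.
move=> a; apply: galgP => x; rewrite gmulE (bigD1 x) //= big1 ?addr0.
  by rewrite gbaseE mulVg eqxx mulr1.
move=> y ny; rewrite gbaseE eq_sym -eq_mulVg1.
by rewrite (negPf ny) mulr0.
Qed.

Lemma gmulDl : left_distributive gmul +%R.
Proof.
move=> a b c; apply: galgP => x; rewrite galgD !gmulE -big_split /=.
by apply: eq_bigr => y _; rewrite galgD mulrDl.
Qed.

Lemma gmulDr : right_distributive gmul +%R.
Proof.
move=> a b c; apply: galgP => x; rewrite galgD !gmulE -big_split /=.
by apply: eq_bigr => y _; rewrite galgD mulrDr.
Qed.

Lemma gbase1_neq0 : gbase 1%g != 0.
Proof.
apply/eqP => /ffunP/(_ 1%g); rewrite gbaseE eqxx ffunE; apply/eqP.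
exact: oner_neq0.
Qed.

HB.instance Definition _ := GRing.Zmodule_isNzRing.Build (galg k gT)
  gmulA gmul1l gmul1r gmulDl gmulDr gbase1_neq0.

Lemma galg_mulE a b x : (a * b) x = \sum_y (a y : k) * (b (y^-1 * x)%g : k).
Proof. exact: gmulE. Qed.

Lemma galg_scaleAl (r : k) a b : r *: (a * b) = r *: a * b.
Proof.
apply: galgP => x; rewrite galgZ !galg_mulE mulr_sumr.
by apply: eq_bigr => y _; rewrite galgZ mulrA.
Qed.

HB.instance Definition _ :=
  GRing.LSemiModule_isLSemiAlgebra.Build k (galg k gT) galg_scaleAl.

Lemma galg_scaleAr (r : k) a b : r *: (a * b) = a * (r *: b).
Proof.
apply: galgP => x; rewrite galgZ !galg_mulE mulr_sumr.
by apply: eq_bigr => y _; rewrite galgZ mulrCA.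
Qed.

HB.instance Definition _ :=
  GRing.LSemiAlgebra_isSemiAlgebra.Build k (galg k gT) galg_scaleAr.

HB.instance Definition _ := Algebra_isFalgebra.Build k (galg k gT).

Lemma gbase_sum a : a = \sum_x (a x : k) *: gbase x.
Proof.
apply: galgP => y; rewrite galg_sumE (bigD1 y) //= big1 ?addr0.
  by rewrite galgZ gbaseE eqxx mulr1.
by move=> x nx; rewrite galgZ gbaseE (negPf nx) mulr0.
Qed.

Lemma gbaseM x y : gbase (x * y)%g = gbase x * gbase y.
Proof.
apply: galgP => z; rewrite galg_mulE (bigD1 x) //= big1 ?addr0.
  by rewrite !gbaseE eqxx mul1r -(inj_eq (mulgI x^-1%g)) mulKg.
by move=> t nt; rewrite gbaseE eq_sym (negPf nt) mul0r.
Qed.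

Lemma gbase1 : gbase 1%g = 1. Proof. by []. Qed.

End GroupAlgebra.

Arguments gbase k {gT} x.

Section Tensor.
Variable k : fieldType.
Implicit Types (hT lT mT iT jT : finGroupType).

(* k[H] (x) k[L] is realized as k[H x L], the pure tensor h (x) l of group    *)
(* elements being the basis vector (h, l).                                    *)
Definition tens hT lT (a : galg k hT) (b : galg k lT) : galg k (hT * lT)%type :=
  [ffun p => (a p.1 : k) * (b p.2 : k)].

(* f (x) g, for linear maps f and g; see tmap_tens. *)
Definition tmap hT lT iT jT (f : galg k hT -> galg k iT)
    (g : galg k lT -> galg k jT) (u : galg k (hT * lT)%type) :
    galg k (iT * jT)%type :=
  \sum_p (u p : k) *: tens (f (gbase k p.1)) (g (gbase k p.2)).

(* The associator (A (x) B) (x) C -> A (x) (B (x) C). *)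
Definition tassoc hT lT mT (u : galg k ((hT * lT) * mT)%type) :
    galg k (hT * (lT * mT))%type :=
  [ffun p => u ((p.1, p.2.1), p.2.2)].

Lemma tensE hT lT (a : galg k hT) (b : galg k lT) p :
  tens a b p = (a p.1 : k) * (b p.2 : k).
Proof. exact: ffunE. Qed.

Lemma tens_linearl hT lT (b : galg k lT) :
  linear ((@tens hT lT)^~ b).
Proof.
by move=> r a a'; apply: galgP => p;
  rewrite galgD galgZ !tensE galgD galgZ mulrDl mulrA.
Qed.

Lemma tens_linearr hT lT (a : galg k hT) : linear (@tens hT lT a).
Proof.
by move=> r b b'; apply: galgP => p;
  rewrite galgD galgZ !tensE galgD galgZ mulrDr mulrCA.
Qed.

HB.instance Definition _ hT lT (a : galg k hT) :=
  GRing.isLinear.Build k (galg k lT) (galg k (hT * lT)%type) _ (tens a)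
    (tens_linearr a).

Lemma tensDl hT lT (b : galg k lT) (I : Type) (r : seq I) (F : I -> galg k hT)
    (C : I -> k) :
  tens (\sum_(i <- r) C i *: F i) b = \sum_(i <- r) C i *: tens (F i) b.
Proof.
elim: r => [|i r IH]; last by rewrite !big_cons tens_linearl IH.
by rewrite !big_nil; apply: galgP => p; rewrite !ffunE mul0r.
Qed.

Lemma tens_gbase hT lT (x : hT) (y : lT) :
  tens (gbase k x) (gbase k y) = gbase k (x, y).
Proof. by apply: galgP => -[u v]; rewrite tensE !gbaseE -natrM mulnb. Qed.

Lemma tensM hT lT (a c : galg k hT) (b d : galg k lT) :
  tens a b * tens c d = tens (a * c) (b * d).
Proof.
apply: galgP => -[x y]; rewrite tensE !galg_mulE /= big_distrlr pair_bigA /=.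
by apply: eq_bigr => -[u v] _; rewrite !tensE /= mulrACA.
Qed.

Lemma tens11 hT lT : tens 1 1 = 1 :> galg k (hT * lT)%type.
Proof. exact: tens_gbase. Qed.

Lemma tmap_linear hT lT iT jT f g : linear (@tmap hT lT iT jT f g).
Proof.
move=> r u v; rewrite /tmap scaler_sumr -big_split /=; apply: eq_bigr => p _.
by rewrite galgD galgZ scalerDl scalerA.
Qed.

HB.instance Definition _ hT lT iT jT f g :=
  GRing.isLinear.Build k (galg k (hT * lT)%type) (galg k (iT * jT)%type) _
    (tmap f g) (@tmap_linear hT lT iT jT f g).

Lemma tmap_tens hT lT iT jT (f : {linear galg k hT -> galg k iT})
    (g : {linear galg k lT -> galg k jT}) a b :
  tmap f g (tens a b) = tens (f a) (g b).
Proof.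
have -> : f a = \sum_x (a x : k) *: f (gbase k x).
  by rewrite [in LHS](gbase_sum a) linear_sum; under eq_bigr do rewrite linearZ.
have -> : g b = \sum_y (b y : k) *: g (gbase k y).
  by rewrite [in LHS](gbase_sum b) linear_sum; under eq_bigr do rewrite linearZ.
rewrite tensDl; under [RHS]eq_bigr do rewrite linear_sum scaler_sumr.
rewrite pair_bigA; apply: eq_bigr => -[x y] _ /=.
by rewrite tensE linearZ /= scalerA.
Qed.

Lemma galg_ind hT (V : lmodType k) (F G : galg k hT -> V) :
  linear F -> linear G -> (forall x, F (gbase k x) = G (gbase k x)) -> F =1 G.
Proof.
move=> lF lG FG u.
pose mF := HB.pack_for {linear galg k hT -> V} F
  (GRing.isLinear.Build k _ V _ F lF).
pose mG := HB.pack_for {linear galg k hT -> V} G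
  (GRing.isLinear.Build k _ V _ G lG).
rewrite (gbase_sum u) -[F _]/(mF _) -[G _]/(mG _) !linear_sum.
by apply: eq_bigr => p _; rewrite !linearZ /= FG.
Qed.

Lemma tens_ind2 hT lT (V : lmodType k) (F G : galg k (hT * lT)%type -> V) :
  linear F -> linear G -> (forall a b, F (tens a b) = G (tens a b)) -> F =1 G.
Proof.
move=> lF lG FG; apply: galg_ind => // -[x y].
by rewrite -tens_gbase FG.
Qed.

Lemma tmapM hT lT iT jT (f : {linear galg k hT -> galg k iT})
    (g : {linear galg k lT -> galg k jT}) :
  {morph f : a b / a * b} -> {morph g : a b / a * b} ->
  {morph tmap f g : u v / u * v}.
Proof.
move=> fM gM u v; apply: (tens_ind2 (F := fun u => tmap f g (u * v))
  (G := fun u => tmap f g u * tmap f g v)) => [r w w'|r w w'|a b].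
- by rewrite mulrDl -scalerAl linearP.
- by rewrite linearP mulrDl -scalerAl.
apply: (tens_ind2 (F := fun v => tmap f g (tens a b * v))
  (G := fun v => tmap f g (tens a b) * tmap f g v)) => [r w w'|r w w'|c d].
- by rewrite mulrDr -scalerAr linearP.
- by rewrite linearP mulrDr -scalerAr.
by rewrite tensM !tmap_tens tensM fM gM.
Qed.

Lemma tassoc_linear hT lT mT : linear (@tassoc hT lT mT).
Proof.
by move=> r u v; apply: galgP => p; rewrite galgD galgZ !ffunE.
Qed.

HB.instance Definition _ hT lT mT :=
  GRing.isLinear.Build k (galg k ((hT * lT) * mT)%type)
    (galg k (hT * (lT * mT))%type) _ _ (@tassoc_linear hT lT mT).

Lemma tassoc_tens hT lT mT (a : galg k hT) (b : galg k lT) (c : galg k mT) :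
  tassoc (tens (tens a b) c) = tens a (tens b c).
Proof. by apply: galgP => p; rewrite ffunE !tensE mulrA. Qed.

Lemma tassocM hT lT mT : {morph @tassoc hT lT mT : u v / u * v}.
Proof.
move=> u v; apply: galgP => -[x [y z]]; rewrite ffunE !galg_mulE /=.
rewrite (reindex (fun p : hT * (lT * mT) => ((p.1, p.2.1), p.2.2))) /=.
  by apply: eq_bigr => -[a [b c]] _; rewrite !ffunE.
by exists (fun p => (p.1.1, (p.1.2, p.2))) => [[? []]|[[]]].
Qed.

Lemma tassoc1 hT lT mT : @tassoc hT lT mT 1 = 1.
Proof. by rewrite -!tens11 tassoc_tens. Qed.

End Tensor.

Section Coproduct.
Variables (k : fieldType) (gT : finGroupType).
Implicit Types (a b : galg k gT).

Definition Delta a : galg k (gT * gT)%type :=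
  \sum_x (a x : k) *: tens (gbase k x) (gbase k x).

Lemma Delta_linear : linear Delta.
Proof.
move=> r u v; rewrite /Delta scaler_sumr -big_split /=; apply: eq_bigr => p _.
by rewrite galgD galgZ scalerDl scalerA.
Qed.

HB.instance Definition _ :=
  GRing.isLinear.Build k (galg k gT) (galg k (gT * gT)%type) _ Delta
    Delta_linear.

Lemma Delta_gbase x : Delta (gbase k x) = tens (gbase k x) (gbase k x).
Proof.
rewrite /Delta (bigD1 x) //= big1 ?addr0; first by rewrite gbaseE eqxx scale1r.
by move=> y ny; rewrite gbaseE eq_sym (negPf ny) scale0r.
Qed.

Lemma Delta1 : Delta 1 = 1.
Proof. by rewrite -tens11 -!gbase1 Delta_gbase. Qed.

Lemma DeltaM : {morph Delta : a b / a * b}.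
Proof.
move=> a b; rewrite (gbase_sum a) (gbase_sum b) mulr_suml !linear_sum mulr_suml.
apply: eq_bigr => x _; rewrite !mulr_sumr !linear_sum; apply: eq_bigr => y _.
rewrite -!scalerAl -!scalerAr !linearZ /= -!scalerAl -!scalerAr -gbaseM.
by rewrite !Delta_gbase tensM gbaseM.
Qed.

Lemma Delta_coassoc a :
  tassoc (tmap Delta idfun (Delta a)) = tmap idfun Delta (Delta a).
Proof.
move: a; apply: galg_ind => [r u v|r u v|x]; try by rewrite !linearP.
by rewrite Delta_gbase !tmap_tens /= Delta_gbase tassoc_tens.
Qed.

End Coproduct.

(* The multiplicative group of units of a ring; {unit R} is only available    *)
(* for finite R.                                                              *)
Definition units (R : unitRingType) := {x : R | x \is a GRing.unit}.
HB.instance Definition _ (R : unitRingType) := SubChoice.on (units R).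

Section Units.
Variable R : unitRingType.
Implicit Types x y z : units R.

Lemma units_mul_subproof x y : val x * val y \is a GRing.unit.
Proof. by rewrite unitrMl ?(valP x) ?(valP y). Qed.
Lemma units_inv_subproof x : (val x)^-1 \is a GRing.unit.
Proof. by rewrite unitrV (valP x). Qed.

Definition units_mul x y : units R := exist (fun t => t \is a GRing.unit) _ (units_mul_subproof x y).
Definition units_inv x : units R := exist (fun t => t \is a GRing.unit) _ (units_inv_subproof x).
Definition units_one : units R := exist (fun t => t \is a GRing.unit) 1 (unitr1 R).

Lemma units_mulA : associative units_mul.
Proof. by move=> x y z; apply: val_inj; rewrite /= mulrA. Qed.
Lemma units_mul1l : left_id units_one units_mul.
Proof. by move=> x; apply: val_inj; rewrite /= mul1r. Qed.
Lemma units_mul1r : right_id units_one units_mul.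
Proof. by move=> x; apply: val_inj; rewrite /= mulr1. Qed.
Lemma units_mulV : left_inverse units_one units_inv units_mul.
Proof. by move=> x; apply: val_inj; rewrite /= mulVr ?(valP x). Qed.
Lemma units_mulrV : right_inverse units_one units_inv units_mul.
Proof. by move=> x; apply: val_inj; rewrite /= mulrV ?(valP x). Qed.

HB.instance Definition _ := isGroup.Build (units R)
  units_mulA units_mul1l units_mul1r units_mulV units_mulrV.

Lemma uvalM x y : \val (x * y)%g = \val x * \val y. Proof. by []. Qed.
Lemma uvalV x : \val x^-1%g = (\val x)^-1. Proof. by []. Qed.
Lemma uval1 : \val (1%g : units R) = 1. Proof. by []. Qed.

End Units.

Section TwistGroups.
Variables (k : fieldType) (gT : finGroupType).
Local Notation kG := (galg k gT).
Local Notation kGG := (galg k (gT * gT)%type).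

Definition is_central : {pred units kG} :=
  [pred a | `[< forall b : kG, \val a * b = b * \val a >]].

Definition is_invariant : {pred units kGG} :=
  [pred F | `[< forall a : kG, Delta a * \val F = \val F * Delta a >]].

Definition A1 := {a : units kG | a \in is_central}.
Definition A2 := {F : units kGG | F \in is_invariant}.
HB.instance Definition _ := SubChoice.on A1.
HB.instance Definition _ := SubChoice.on A2.

Lemma comm_divr (R : unitRingType) (b x y : R) : y \is a GRing.unit ->
  x * b = b * x -> y * b = b * y -> (x / y) * b = b * (x / y).
Proof.
move=> uy xb yb; have : y^-1 * b = b * y^-1.
  by apply: (mulrI uy); rewrite mulVKr // mulrA yb mulrK.
by move=> yVb; rewrite -mulrA yVb !mulrA xb.
Qed.

Lemma is_central_closed : group_closed is_central.
Proof.
split; first by apply/asboolP => b; rewrite /= mul1r mulr1.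
move=> x y /asboolP xP /asboolP yP; apply/asboolP => b.
exact: (comm_divr (valP y)).
Qed.

Lemma is_invariant_closed : group_closed is_invariant.
Proof.
split; first by apply/asboolP => b; rewrite /= mul1r mulr1.
move=> x y /asboolP xP /asboolP yP; apply/asboolP => b; apply/esym.
by apply: (comm_divr (valP y)) => //=; apply/esym.
Qed.

HB.instance Definition _ :=
  SubChoice_isSubGroup.Build _ is_central A1 is_central_closed.
HB.instance Definition _ :=
  SubChoice_isSubGroup.Build _ is_invariant A2 is_invariant_closed.

Definition A1_alg (a : A1) : kG := \val (\val a).
Definition A2_alg (F : A2) : kGG := \val (\val F).

(* (F (x) 1) (Delta (x) id)(F) = (1 (x) F) (id (x) Delta)(F), the two sides    *)
(* living in (k[G] (x) k[G]) (x) k[G] and k[G] (x) (k[G] (x) k[G]).           *)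
Definition is_twist : {pred A2} :=
  [pred F | tassoc (tens (A2_alg F) 1 * tmap (@Delta k gT) idfun (A2_alg F))
            == tens 1 (A2_alg F) * tmap idfun (@Delta k gT) (A2_alg F)].

Definition Z2 := {F : A2 | F \in is_twist}.
HB.instance Definition _ := SubChoice.on Z2.

Lemma A2P (F : A2) a : Delta a * A2_alg F = A2_alg F * Delta a.
Proof. by have /asboolP := valP F. Qed.
Lemma A2_algM (F F' : A2) : A2_alg (F * F')%g = A2_alg F * A2_alg F'.
Proof. by []. Qed.
Lemma A2_alg1 : A2_alg 1%g = 1. Proof. by []. Qed.
Lemma A2_alg_inj : injective A2_alg.
Proof. by move=> F F' /val_inj/val_inj. Qed.

Definition twistL (F : kGG) : galg k (gT * (gT * gT))%type :=
  tassoc (tens F 1 * tmap (@Delta k gT) idfun F).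
Definition twistR (F : kGG) : galg k (gT * (gT * gT))%type :=
  tens 1 F * tmap idfun (@Delta k gT) F.

Lemma twistLM (F F' : kGG) : (forall a, Delta a * F' = F' * Delta a) ->
  twistL (F * F') = twistL F * twistL F'.
Proof.
move=> inv; rewrite /twistL -tassocM; congr (tassoc _).
rewrite tmapM //; last exact: DeltaM.
have -> : tens (F * F') (1 : kG) = tens F 1 * tens F' 1 by rewrite tensM mulr1.
rewrite -!mulrA; congr (_ * _); rewrite !mulrA; congr (_ * _).
rewrite /tmap mulr_sumr mulr_suml; apply: eq_bigr => p _.
by rewrite -scalerAl -scalerAr !tensM mulr1 mul1r inv.
Qed.

Lemma twistRM (F F' : kGG) : (forall a, Delta a * F' = F' * Delta a) ->
  twistR (F * F') = twistR F * twistR F'.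
Proof.
move=> inv; rewrite /twistR tmapM //; last exact: DeltaM.
have -> : tens (1 : kG) (F * F') = tens 1 F * tens 1 F' by rewrite tensM mulr1.
rewrite -!mulrA; congr (_ * _); rewrite !mulrA; congr (_ * _).
rewrite /tmap mulr_sumr mulr_suml; apply: eq_bigr => p _.
by rewrite -scalerAl -scalerAr !tensM mulr1 mul1r inv.
Qed.

Lemma twistL1 : twistL 1 = 1.
Proof.
rewrite /twistL -[X in tmap _ _ X]tens11 tmap_tens /= Delta1 !tens11 mulr1.
exact: tassoc1.
Qed.

Lemma twistR1 : twistR 1 = 1.
Proof. by rewrite /twistR -[X in tmap _ _ X]tens11 tmap_tens /= Delta1 !tens11 mulr1. Qed.

Lemma is_twistE F : (F \in is_twist) = (twistL (A2_alg F) == twistR (A2_alg F)).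
Proof. by []. Qed.

Lemma is_twist_closed : group_closed is_twist.
Proof.
split; first by rewrite is_twistE A2_alg1 twistL1 twistR1.
move=> F F'; rewrite !is_twistE => /eqP FP /eqP F'P.
have L : twistL (A2_alg F'^-1%g) * twistL (A2_alg F') = 1.
  by rewrite -twistLM -?A2_algM ?mulVg ?A2_alg1 ?twistL1 //; apply: A2P.
have R : twistR (A2_alg F') * twistR (A2_alg F'^-1%g) = 1.
  by rewrite -twistRM -?A2_algM ?mulgV ?A2_alg1 ?twistR1 //; apply: A2P.
have LR : twistL (A2_alg F'^-1%g) = twistR (A2_alg F'^-1%g).
  by rewrite -[LHS]mulr1 -R mulrA -F'P L mul1r.
by rewrite A2_algM twistLM ?twistRM ?FP ?LR //; apply: A2P.
Qed.

HB.instance Definition _ :=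
  SubChoice_isSubGroup.Build _ is_twist Z2 is_twist_closed.

Definition Z2_alg (F : Z2) : kGG := A2_alg (\val F).

Lemma Z2_alg_inj : injective Z2_alg.
Proof. by move=> F F' /A2_alg_inj/val_inj. Qed.
Lemma Z2_algM (F F' : Z2) : Z2_alg (F * F')%g = Z2_alg F * Z2_alg F'.
Proof. by []. Qed.
Lemma Z2P (F : Z2) a : Delta a * Z2_alg F = Z2_alg F * Delta a.
Proof. exact: A2P. Qed.

Lemma A1P (a : A1) b : A1_alg a * b = b * A1_alg a.
Proof. by have /asboolP := valP a. Qed.
Lemma A1_algM a b : A1_alg (a * b)%g = A1_alg a * A1_alg b.
Proof. by []. Qed.
Lemma A1_alg1 : A1_alg 1%g = 1. Proof. by []. Qed.
Lemma A1_algV a : A1_alg a^-1%g = (A1_alg a)^-1. Proof. by []. Qed.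
Lemma A1_mulVr a : (A1_alg a)^-1 * A1_alg a = 1.
Proof. by rewrite -A1_algV -A1_algM mulVg. Qed.
Lemma A1_mulrV a : A1_alg a / A1_alg a = 1.
Proof. by rewrite -A1_algV -A1_algM mulgV. Qed.
Lemma A1_invC a b : (A1_alg a)^-1 * b = b / A1_alg a.
Proof. by rewrite -A1_algV A1P. Qed.

Definition delta1_alg (a : A1) : kGG :=
  tens (A1_alg a) (A1_alg a) * Delta (A1_alg a)^-1.

Lemma tens_A1C (a b : A1) (u : kGG) :
  tens (A1_alg a) (A1_alg b) * u = u * tens (A1_alg a) (A1_alg b).
Proof.
apply: (tens_ind2 (F := fun u => _ * u) (G := fun u => u * _)) => [r x y|r x y|c d].
- by rewrite mulrDr scalerAr.
- by rewrite mulrDl scalerAl.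
by rewrite !tensM !A1P.
Qed.

Lemma delta1_algM a b : delta1_alg (a * b)%g = delta1_alg a * delta1_alg b.
Proof.
rewrite /delta1_alg !A1_algM -tensM -!mulrA; congr (_ * _).
rewrite !mulrA -tens_A1C -!mulrA -DeltaM; congr (_ * Delta _).
by rewrite -A1_algM -A1_algV invgM A1_algM !A1_algV A1_invC.
Qed.

Lemma delta1_alg1 : delta1_alg 1%g = 1.
Proof. by rewrite /delta1_alg A1_alg1 invr1 Delta1 tens11 mulr1. Qed.

Lemma delta1_unit_subproof a : delta1_alg a \is a GRing.unit.
Proof.
apply/unitrP; exists (delta1_alg a^-1%g).
by rewrite -!delta1_algM mulVg mulgV delta1_alg1.
Qed.
Definition delta1_unit a : units kGG := exist (fun t => t \is a GRing.unit) _ (delta1_unit_subproof a).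

Lemma Delta_A1VC a b : Delta b * Delta (A1_alg a)^-1 = Delta (A1_alg a)^-1 * Delta b.
Proof. by rewrite -!DeltaM A1_invC. Qed.

Lemma delta1_invariant_subproof a : delta1_unit a \in is_invariant.
Proof.
apply/asboolP => b; rewrite /= /delta1_alg -mulrA -Delta_A1VC !mulrA.
by rewrite tens_A1C.
Qed.
Definition delta1_A2 a : A2 := exist (fun t => t \in is_invariant) _ (delta1_invariant_subproof a).

Lemma delta1_twist_subproof a : delta1_A2 a \in is_twist.
Proof.
rewrite is_twistE -[A2_alg _]/(delta1_alg a) /delta1_alg.
rewrite twistLM ?twistRM; try exact: Delta_A1VC.
set b := A1_alg a; have DbV : Delta b * Delta b^-1 = 1.
  by rewrite -DeltaM A1_mulrV Delta1.
rewrite /twistL /twistR -tassocM !tmap_tens /= !mulrA !tensM !mulr1 !mul1r.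
by rewrite -!mulrA !DbV !mulr1 tassocM Delta_coassoc tassoc_tens.
Qed.
Definition delta1 a : Z2 := exist (fun t => t \in is_twist) _ (delta1_twist_subproof a).

Lemma delta1E a : Z2_alg (delta1 a) =
  tens (A1_alg a) (A1_alg a) * Delta (A1_alg a)^-1.
Proof. by []. Qed.

Lemma delta1M : {morph delta1 : a b / (a * b)%g}.
Proof. by move=> a b; apply: Z2_alg_inj; apply: delta1_algM. Qed.

Lemma delta1C a (F : Z2) : (delta1 a * F = F * delta1 a)%g.
Proof.
apply: Z2_alg_inj; rewrite !Z2_algM !delta1E -mulrA Z2P !mulrA.
by rewrite tens_A1C.
Qed.

(* F and F' lie in the same coset of the central subgroup delta1(A1) of Z2. *)
Definition coset_rel : rel Z2 :=
  [rel F F' | `[< exists a : A1, (F' = F * delta1 a)%g >]].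

Lemma delta1_1 : delta1 1%g = 1%g.
Proof. by apply: Z2_alg_inj; apply: delta1_alg1. Qed.

Lemma coset_refl : reflexive coset_rel.
Proof. by move=> F; apply/asboolP; exists 1%g; rewrite delta1_1 mulg1. Qed.
Lemma coset_sym : symmetric coset_rel.
Proof.
move=> F F'; apply/asboolP/asboolP => -[a ->]; exists a^-1%g;
  by rewrite -mulgA -delta1M mulgV delta1_1 mulg1.
Qed.
Lemma coset_trans : transitive coset_rel.
Proof.
move=> F F' F'' /asboolP[a ->] /asboolP[b ->]; apply/asboolP.
by exists (a * b)%g; rewrite delta1M mulgA.
Qed.

Canonical coset_equiv := EquivRel coset_rel coset_refl coset_sym coset_trans.

Definition H2l := {eq_quot coset_equiv}.
HB.instance Definition _ := Choice.on H2l.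
HB.instance Definition _ := EqQuotient.on H2l.

Lemma H2l_eqP (F F' : Z2) :
  reflect (exists a : A1, (F' = F * delta1 a)%g) (F == F' %[mod H2l]).
Proof. by rewrite eqmodE; apply: asboolP. Qed.

Definition H2l_mul := lift_op2 H2l (@mul Z2).
Definition H2l_inv := lift_op1 H2l (@inv Z2).
Definition H2l_one : H2l := lift_cst H2l (1%g : Z2).

Lemma pi_H2l_mul : {morph \pi_H2l : F F' / (F * F')%g >-> H2l_mul F F'}.
Proof.
move=> F F'; unlock H2l_mul; apply/eqP/H2l_eqP.
have /H2l_eqP[a ->] : F == generic_quotient.repr (\pi_H2l F) %[mod H2l].
  by rewrite reprK.
have /H2l_eqP[b ->] : F' == generic_quotient.repr (\pi_H2l F') %[mod H2l].
  by rewrite reprK.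
exists (a * b)%g; rewrite delta1M -!mulgA; congr (_ * _)%g.
by rewrite mulgA (delta1C a F') -mulgA.
Qed.
Canonical pi_H2l_mul_morph := PiMorph2 pi_H2l_mul.

Lemma pi_H2l_inv : {morph \pi_H2l : F / (F^-1)%g >-> H2l_inv F}.
Proof.
move=> F; unlock H2l_inv; apply/eqP/H2l_eqP.
have /H2l_eqP[a ->] : F == generic_quotient.repr (\pi_H2l F) %[mod H2l].
  by rewrite reprK.
exists a^-1%g; rewrite invgM -delta1C; congr (_ * _)%g.
by apply: mulg1_eq; rewrite -delta1M mulgV delta1_1.
Qed.
Canonical pi_H2l_inv_morph := PiMorph1 pi_H2l_inv.
Canonical pi_H2l_one_morph := PiConst H2l_one.

Lemma H2l_mulA : associative H2l_mul.
Proof. by move=> x y z; rewrite -[x]reprK -[y]reprK -[z]reprK !piE mulgA. Qed.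
Lemma H2l_mul1l : left_id H2l_one H2l_mul.
Proof. by move=> x; rewrite -[x]reprK !piE mul1g. Qed.
Lemma H2l_mul1r : right_id H2l_one H2l_mul.
Proof. by move=> x; rewrite -[x]reprK !piE mulg1. Qed.
Lemma H2l_mulV : left_inverse H2l_one H2l_inv H2l_mul.
Proof. by move=> x; rewrite -[x]reprK !piE mulVg. Qed.
Lemma H2l_mulrV : right_inverse H2l_one H2l_inv H2l_mul.
Proof. by move=> x; rewrite -[x]reprK !piE mulgV. Qed.

HB.instance Definition _ := isGroup.Build H2l
  H2l_mulA H2l_mul1l H2l_mul1r H2l_mulV H2l_mulrV.

End TwistGroups.

Definition abelian_group (X : groupType) := commutative (@mul X).

(* The module of rG is a direct sum of pairwise non-isomorphic simple         *)
(* submodules, i.e. every irreducible representation is isomorphic to at most *)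
(* one of the simple summands.                                                *)
Definition multiplicity_free (k : fieldType) (gT : finGroupType)
    (G : {group gT}) (n : nat) (rG : mx_representation k G n) : Prop :=
  exists (I : finType) (U : I -> 'M[k]_n),
    [/\ forall i, mxsimple rG (U i),
        (\sum_i U i :=: 1%:M)%MS,
        mxdirect (\sum_i U i)
      & forall i j, mx_iso rG (U i) (U j) -> i = j].

Definition no_multiplicities (k : fieldType) (gT : finGroupType) : Prop :=
  forall (m n : nat) (rV : mx_representation k [set: gT] m)
    (rW : mx_representation k [set: gT] n),
  mx_irreducible rV -> mx_irreducible rW ->
  multiplicity_free (prod_repr rV rW).

(* Main.v *)
Require Import Defs.
From HB Require Import structures.
From mathcomp Require Import all_boot all_order all_algebra all_fingroup.
From mathcomp Require Import all_solvable all_field all_character.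

(** An invariant element of k[G] (x) k[G] acts on V (x) W by an endomorphism of
    the G-module V (x) W. When V (x) W is multiplicity-free and k is
    algebraically closed, Schur's lemma makes the algebra of these endomorphisms
    commutative, so the commutator of two invariant elements acts as zero on all
    V (x) W with V and W irreducible. By Maschke's theorem the irreducible
    representations separate the elements of k[G], hence the V (x) W separate
    those of k[G] (x) k[G], and the commutator vanishes. *)

Set Implicit Arguments.
Unset Strict Implicit.
Unset Printing Implicit Defensive.

Import GroupScope GRing.Theory.
Local Open Scope ring_scope.

Section MultiplicityFree.
Variables (k : fieldType) (gT : finGroupType) (G : {group gT}).
Variables (n : nat) (rG : mx_representation k G n).
Variables (I : finType) (U : I -> 'M[k]_n).
Hypotheses (simU : forall i, mxsimple rG (U i)).
Hypotheses (sumU : (\sum_i U i :=: 1%:M)%MS) (dxU : mxdirect (\sum_i U i)).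
Hypothesis isoU : forall i j, mx_iso rG (U i) (U j) -> i = j.

(* Otherwise the projection of f (U i) to the other summands would be isomorphic
   to U i, hence to one of them. *)
Lemma centgmx_stable_summand (f : 'M[k]_n) (i : I) :
  centgmx rG f -> (U i *m f <= U i)%MS.
Proof.
move=> cf; pose S := (\sum_(j | j != i) U j)%MS.
have modU j : mxmodule rG (U j) by case: (simU j).
have modS : mxmodule rG S by apply: sumsmx_module => j _.
have US0 : (U i :&: S = 0)%MS by move/mxdirect_sumsP: dxU => /(_ i isT).
have US1 : (U i + S :=: 1%:M)%MS.
  by apply: eqmx_trans sumU; rewrite [X in (_ :=: X)%MS](bigD1 i).
have fdec : U i *m f *m proj_mx (U i) S + U i *m f *m proj_mx S (U i) = U i *m f.
  by apply: add_proj_mx => //; rewrite US1 submx1.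
(* [proj_mx S (U i)] projects onto [S] along [U i]; if it kills [U i *m f], then [fdec] leaves only
   a component in [U i]. *)
suff fS0 : U i *m (f *m proj_mx S (U i)) = 0.
  by rewrite -fdec -[X in _ + X]mulmxA fS0 addr0 proj_mx_sub.
apply/eqP/negPn/negP => nz.
have homg : (U i <= dom_hom_mx rG (f *m proj_mx S (U i)))%MS.
  have homp : (U i *m f <= dom_hom_mx rG (proj_mx S (U i)))%MS.
    apply: submx_trans (proj_mx_hom _ modS (modU i)); last by rewrite capmxC.
    by rewrite addsmxC US1 submx1.
  apply/hom_mxP => x Gx; rewrite (mulmxA (U i)) -(hom_mxP homp) // (mulmxA _ f).
  by rewrite -(mulmxA (U i) (rG x)) -(centgmxP cf) // (mulmxA (U i) f).
have isog := mx_Schur_inj_iso (simU i) homg nz.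
(* The identity presents [S] as a homomorphic image of a sum of simple modules, the form in which
   [hom_mxsemisimple_iso] finds a summand isomorphic to the projection. *)
have sub : (U i *m (f *m proj_mx S (U i)) <= S *m 1%:M)%MS.
  by rewrite mulmx1 mulmxA proj_mx_sub.
have [j nji isoj] := hom_mxsemisimple_iso (mx_iso_simple isog (simU i))
  (fun j _ _ => simU j) (scalar_mx_hom _ _ _) sub.
by case/eqP: nji; apply: isoU; apply: mx_iso_trans isoj (mx_iso_sym isog).
Qed.

End MultiplicityFree.

(** Schur's lemma: over an algebraically closed field [f] has an eigenvector in [U] for some [c], so
    [f - c%:M] is not injective on the simple module [U] and vanishes there. *)
Lemma centgmx_simple_scalar (k : closedFieldType) (gT : finGroupType)
    (G : {group gT}) n (rG : mx_representation k G n) (U f : 'M[k]_n) :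
  mxsimple rG U -> centgmx rG f -> (U *m f <= U)%MS ->
  exists c, U *m f = c *: U.
Proof.
move=> simU cf stU; have [_ nzU _] := simU.
(* [g] is the restriction of [f] to [U] in coordinates; its characteristic polynomial has degree
   [\rank U > 0], hence a root. *)
pose g := in_submod U (val_submod (1%:M : 'M_(\rank U)) *m f).
have [c gc] : exists c, root (char_poly g) c.
  by apply/closed_rootP; rewrite size_char_poly eqSS mxrank_eq0.
move: gc; rewrite -eigenvalue_root_char => /eigenvalueP[w wg nzw].
exists c; apply/eqP; rewrite -subr_eq0 -mul_mx_scalar -mulmxBr.
apply/negPn/negP => nz.
have homh : (U <= dom_hom_mx rG (f - c%:M))%MS.
  apply: centgmx_hom; apply/centgmxP => x Gx.
  by rewrite mulmxBl mulmxBr (centgmxP cf) // scalar_mxC.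
have := mx_Schur_inj simU homh nz; move/eqP; apply/negP.
apply/rowV0Pn; exists (val_submod w); last by rewrite val_submod_eq0.
rewrite sub_capmx val_submodP; apply/sub_kermxP.
have wgE : w *m g = in_submod U (val_submod w *m f).
  by rewrite /g in_submodE mulmxA -in_submodE mulmxA -val_submodE.
rewrite mulmxBr mul_mx_scalar -linearZ /= -wg wgE in_submodK ?subrr //.
by apply: submx_trans (submxMr _ (val_submodP w)) stU.
Qed.

(** Both matrices act by scalars on each simple summand, so their commutator kills every summand and
    hence the whole space. *)
Lemma multiplicity_free_centgmxC (k : closedFieldType) (gT : finGroupType)
    (G : {group gT}) n (rG : mx_representation k G n) (f g : 'M[k]_n) :
  multiplicity_free rG -> centgmx rG f -> centgmx rG g -> f *m g = g *m f.
Proof.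
move=> [I [U [simU sumU dxU isoU]]] cf cg.
apply/eqP; rewrite -subr_eq0 -[_ - _]mul1mx; apply/eqP/sub_kermxP.
rewrite -sumU; apply/sumsmx_subP => i _; apply/sub_kermxP.
have stU := centgmx_stable_summand simU sumU dxU isoU i.
have [c fc] := centgmx_simple_scalar (simU i) cf (stU f cf).
have [d gd] := centgmx_simple_scalar (simU i) cg (stU g cg).
rewrite mulmxBr !mulmxA fc gd -!scalemxAl fc gd.
by rewrite !scalerA mulrC subrr.
Qed.

Section Action.
Variables (k : fieldType) (gT : finGroupType).
Variables (n : nat) (rG : mx_representation k [set: gT] n).

Definition galg_act (a : galg k gT) : 'M[k]_n := \sum_x (a x : k) *: rG x.

Lemma galg_act_linear : linear galg_act.
Proof.
move=> r a b; rewrite /galg_act scaler_sumr -big_split /=.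
by apply: eq_bigr => x _; rewrite galgD galgZ scalerDl scalerA.
Qed.

HB.instance Definition _ := GRing.isLinear.Build k (galg k gT) 'M[k]_n _
  galg_act galg_act_linear.

Lemma galg_act_gbase x : galg_act (gbase k x) = rG x.
Proof.
rewrite /galg_act (bigD1 x) //= big1 ?addr0; first by rewrite gbaseE eqxx scale1r.
by move=> y ny; rewrite gbaseE eq_sym (negPf ny) scale0r.
Qed.

Lemma galg_actM a b : galg_act (a * b) = galg_act a *m galg_act b.
Proof.
rewrite {1}(gbase_sum a) mulr_suml linear_sum /= /galg_act mulmx_suml.
apply: eq_bigr => x _; rewrite {1}(gbase_sum b) mulr_sumr -!/(galg_act _).
rewrite linear_sum mulmx_sumr; apply: eq_bigr => y _.
rewrite -scalerAl -scalerAr -gbaseM !linearZ /= -scalemxAl.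
by rewrite galg_act_gbase repr_mxM ?inE // !scalerA mulrC.
Qed.

End Action.

(** By Maschke's theorem the regular module is a sum of simple submodules, so [a] kills it; the
    regular representation is faithful on the group algebra. *)
Lemma galg_act_irr_eq0 (k : fieldType) (gT : finGroupType) (a : galg k gT) :
  [pchar k]^'.-group [set: gT] ->
  (forall n (rG : mx_representation k [set: gT] n),
     mx_irreducible rG -> galg_act rG a = 0) -> a = 0.
Proof.
move=> chG a0; pose aG := regular_repr k [set: gT].
have simA U : mxsimple aG U -> (U <= kermx (galg_act aG a))%MS.
  move=> simU; have modU := mxsimple_module simU.
  have /a0 : mx_irreducible (submod_repr modU) by apply/submod_mx_irr.
  (* The vanishing of [a] on the subrepresentation is carried back from coordinates to the rows of
     [U]. *)
  move/(congr1 (fun M => val_submod (1%:M *m M))); rewrite mulmx0 linear0 => aU.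
  rewrite -(val_submod1 U); apply/sub_kermxP; rewrite -{}[RHS]aU.
  rewrite /galg_act !mulmx_sumr linear_sum; apply: eq_bigr => x _.
  by rewrite -!scalemxAr linearZ /= -val_submodJ ?inE // mul1mx.
have aG0 : galg_act aG a = 0.
  rewrite -[LHS]mul1mx; apply/sub_kermxP.
  apply: (mx_reducible_semisimple (mxmodule1 aG) (mx_Maschke_pchar aG chG)).
  by case=> I U /= simU <- _; apply/sumsmx_subP => i _; apply: simA.
apply: galgP => x; rewrite [RHS]ffunE.
(* [gring_proj x] sends [aG y] to 1 if [y = x] and to 0 otherwise, so it extracts the coefficient
   [a x]. *)
have : gring_proj x (galg_act aG a) = 0 by rewrite aG0 linear0.
rewrite /galg_act linear_sum (bigD1 x) //= big1 => [|y ny].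
  rewrite addr0 linearZ /= gring_projE ?inE // eqxx => /matrixP/(_ 0 0).
  by rewrite !mxE eqxx mulr1.
by rewrite linearZ /= gring_projE ?inE // eq_sym (negPf ny) scaler0.
Qed.

Section ExternalProduct.
Variables (k : fieldType) (hT lT : finGroupType) (m n : nat).
Variables (rV : mx_representation k [set: hT] m).
Variables (rW : mx_representation k [set: lT] n).

Lemma ext_prod_mx_repr :
  mx_repr [set: hT * lT] (fun p => tprod (rV p.1) (rW p.2)).
Proof.
split=> [|p q _ _]; first by rewrite !repr_mx1 tprod1.
by rewrite !repr_mxM ?inE // tprodE.
Qed.

(** For equal groups, restriction to the diagonal gives [prod_repr]. *)
Definition ext_prod_repr := MxRepresentation ext_prod_mx_repr.

(* [A i j * B s t] is the trace of [tprod A B *m tprod (delta j i) (delta t s)]. *)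
Lemma ext_prod_act_coef (u : galg k (hT * lT)%type) i j s t :
  galg_act ext_prod_repr u = 0 ->
  \sum_p (u p : k) * (rV p.1 i j * rW p.2 s t) = 0.
Proof.
have tr_delta q (A : 'M[k]_q) a b : \tr (A *m delta_mx b a) = A a b.
  by rewrite mxtrace_mulC -[delta_mx b a](@mul_delta_mx _ _ 1 _ 0) -mulmxA mxtrace_mulC -rowE trace_mx11 -colE !mxE.
move=> u0.
have : \tr (galg_act ext_prod_repr u *m tprod (delta_mx j i) (delta_mx t s)) = 0.
  by rewrite u0 mul0mx mxtrace0.
rewrite /galg_act mulmx_suml linear_sum => {2}<-; apply: eq_bigr => p _.
by rewrite -scalemxAl linearZ /= -tprodE mxtrace_prod !tr_delta.
Qed.

End ExternalProduct.

(** The factors are separated one at a time: contracting the first with a matrix coefficient of V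
    gives an element of k[L] killed by every irreducible W, hence zero; then each slice [u (_, y)]
    is killed by every irreducible V. *)
Lemma ext_prod_act_irr_eq0 (k : fieldType) (hT lT : finGroupType)
    (u : galg k (hT * lT)%type) :
  [pchar k]^'.-group [set: hT] -> [pchar k]^'.-group [set: lT] ->
  (forall m n (rV : mx_representation k [set: hT] m)
     (rW : mx_representation k [set: lT] n),
     mx_irreducible rV -> mx_irreducible rW ->
     galg_act (ext_prod_repr rV rW) u = 0) -> u = 0.
Proof.
move=> chH chL u0.
have uV0 m (rV : mx_representation k [set: hT] m) i j : mx_irreducible rV ->
    [ffun y => \sum_x (u (x, y) : k) * rV x i j] = 0 :> galg k lT.
  move=> irrV; apply: galg_act_irr_eq0 => // n rW irrW; apply/matrixP => s t.
  rewrite mxE -[RHS](ext_prod_act_coef i j s t (u0 _ _ _ _ irrV irrW)).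
  rewrite summxE [RHS](eq_bigr (fun p => (u (p.1, p.2) : k) *
    (rV p.1 i j * rW p.2 s t))) => [|[x y] _ //].
  rewrite -(pair_bigA _ (fun x y => (u (x, y) : k) * (rV x i j * rW y s t))).
  rewrite exchange_big; apply: eq_bigr => y _.
  by rewrite mxE ffunE mulr_suml; apply: eq_bigr => x _; rewrite mulrA.
apply: galgP => -[x y]; rewrite [RHS]ffunE.
have : [ffun z => u (z, y)] = 0 :> galg k hT.
  apply: galg_act_irr_eq0 => // m rV irrV; apply/matrixP => i j.
  move/ffunP/(_ y): (uV0 m rV i j irrV); rewrite !ffunE mxE => <-.
  by rewrite summxE; apply: eq_bigr => z _; rewrite mxE ffunE.
by move/ffunP/(_ x); rewrite !ffunE.
Qed.

(** [Delta] sends a group element to its diagonal pair, which acts on V (x) W as that element does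
    through [prod_repr]. *)
Lemma ext_prod_act_centgmx (k : fieldType) (gT : finGroupType) m n
    (rV : mx_representation k [set: gT] m) (rW : mx_representation k [set: gT] n)
    (F : galg k (gT * gT)%type) :
  (forall a, Delta a * F = F * Delta a) ->
  centgmx (prod_repr rV rW) (galg_act (ext_prod_repr rV rW) F).
Proof.
move=> invF; apply/centgmxP => x _.
have -> : prod_repr rV rW x = galg_act (ext_prod_repr rV rW) (Delta (gbase k x)).
  by rewrite Delta_gbase tens_gbase galg_act_gbase.
by rewrite -!galg_actM invF.
Qed.

Lemma A2_abelian (k : closedFieldType) (gT : finGroupType) :
  [pchar k]^'.-group [set: gT] -> no_multiplicities k gT ->
  abelian_group (A2 k gT).
Proof.
move=> chG nomult F F'; apply: A2_alg_inj; rewrite !A2_algM.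
apply/eqP; rewrite -subr_eq0; apply/eqP; apply: ext_prod_act_irr_eq0 => //.
move=> m n rV rW irrV irrW; rewrite linearB /= !galg_actM.
apply/eqP; rewrite subr_eq0; apply/eqP.
apply: (multiplicity_free_centgmxC (nomult _ _ _ _ irrV irrW));
  by apply: ext_prod_act_centgmx => a; apply: A2P.
Qed.

(** Commutativity passes to the subgroup [Z2] of [A2] and then to its quotient. *)
Lemma H2l_abelian (k : fieldType) (gT : finGroupType) :
  abelian_group (A2 k gT) -> abelian_group (H2l k gT).
Proof.
move=> abA x y; rewrite -[x]generic_quotient.reprK -[y]generic_quotient.reprK.
rewrite -[LHS]/(H2l_mul _ _) -[RHS]/(H2l_mul _ _) -!pi_H2l_mul.
by congr (generic_quotient.pi _ _); apply: Z2_alg_inj; congr A2_alg; apply: abA.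
Qed.

Theorem proposition5p1 (k : closedFieldType) (gT : finGroupType)
    (char0 : [pchar k]%R =i pred0) (nomult : no_multiplicities k gT) :
  abelian_group (A2 k gT) /\ abelian_group (H2l k gT).
Proof.
(* In characteristic zero no prime belongs to [[pchar k]], so Maschke's theorem applies to every
   finite group. *)
have chG : [pchar k]^'.-group [set: gT].
  by apply/pgroupP => p _ _; rewrite inE /= char0.
have abA := A2_abelian chG nomult.
by split=> //; apply: H2l_abelian.
Qed.
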